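(* For every integer $n\geqslant 2$ the semigroup $\mathscr{IO}_{\infty}(\mathbb{Z}^n_{\mathrm{lex}})$ has a non-inner automorphism; namely, under the identification of $\mathscr{IO}_{\infty}(\mathbb{Z}^n_{\mathrm{lex}})$ with $(\mathscr{IO}_{\infty}(\mathbb{Z}))^n$, the map $\mathfrak{h}$ defined by $(\alpha_1,\alpha_2,\alpha_3,\ldots,\alpha_n)\mathfrak{h}=(\alpha_2,\alpha_1,\alpha_3,\ldots,\alpha_n)$ is an automorphism which is not inner.
   Context: $L_n=\{1,\ldots,n\}$ with its usual order; $L_n\times_{\mathrm{lex}}\mathbb{Z}$ is $L_n\times\mathbb{Z}$ with the lexicographic order: $(i,m)\leqslant(j,l)$ iff $i<j$, or $i=j$ and $m\le l$. $\mathscr{IO}_{\infty}(\mathbb{Z}^n_{\mathrm{lex}})$ is the inverse monoid of all injective partial maps $\alpha$ from $L_n\times\mathbb{Z}$ to itself that are monotone ($x\leqslant y$ in $\operatorname{dom}\alpha$ implies $(x)\alpha\leqslant(y)\alpha$) and such that both $\operatorname{dom}\alpha$ and $\operatorname{ran}\alpha$ have finite complement in $L_n\times\mathbb{Z}$; the operation is composition of partial maps written on the right, $(x)(\alpha\beta)=((x)\alpha)\beta$. $\mathscr{IO}_{\infty}(\mathbb{Z})$ is the analogous monoid of injective monotone partial selfmaps of $\mathbb{Z}$ (usual order) with cofinite domain and image. Every element of $\mathscr{IO}_{\infty}(\mathbb{Z}^n_{\mathrm{lex}})$ preserves the first coordinate, so $\mathscr{IO}_{\infty}(\mathbb{Z}^n_{\mathrm{lex}})$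 is identified with the direct power $(\mathscr{IO}_{\infty}(\mathbb{Z}))^n$ by $\alpha\leftrightarrow(\alpha_1,\ldots,\alpha_n)$, where $(i,k)\alpha=(i,(k)\alpha_i)$. An automorphism $\mathfrak{f}$ of a monoid $S$ with group of units $H_1$ is called inner if there exists $a\in H_1$ such that $(s)\mathfrak{f}=asa^{-1}$ for all $s\in S$. *)

(* Defs.v *)
From HB Require Import structures.
From mathcomp Require Import all_boot all_order all_algebra all_fingroup.
From mathcomp Require Import boolp classical_sets functions cardinality.
From mathcomp Require Import zify.

Set Implicit Arguments.
Unset Strict Implicit.
Unset Printing Implicit Defensive.

Import Order.TTheory.

Local Open Scope classical_set_scope.

Section PartialMaps.
Context {d : Order.disp_t} {T : orderType d}.
Implicit Types f g : T -> option T.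

Definition pdom f : set T := [set x | exists y, f x = Some y].
Definition pran f : set T := [set y | exists x, f x = Some y].

Definition pinjective f : Prop :=
  forall x x' y, f x = Some y -> f x' = Some y -> x = x'.

Definition pmonotone f : Prop :=
  forall x x' y y', f x = Some y -> f x' = Some y' ->
    (x <= x')%O -> (y <= y')%O.

Definition IO_axiom f : Prop :=
  [/\ pinjective f, pmonotone f, cofinite_set (pdom f) & cofinite_set (pran f)].

Definition pinv f : T -> option T := fun y =>
  if pselect (pran f y) is left P then Some (projT1 (cid P)) else None.

End PartialMaps.

Record IO {d : Order.disp_t} (T : orderType d) := MkIO {
  pfun :> T -> option T;
  pfunP : IO_axiom pfun }.

Section IOMonoid.
Context {d : Order.disp_t} {T : orderType d}.
Implicit Types a b c : IO T.

Lemma IO_ext a b : (forall x, a x = b x) -> a = b.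
Proof.
case: a b => [f fP] [g gP] /= /funext fg.
by subst g; rewrite (Prop_irrelevance fP gP).
Qed.

Lemma IO_inj a x x' y : a x = Some y -> a x' = Some y -> x = x'.
Proof. by case: (pfunP a) => + _ _ _; apply. Qed.

Lemma IO_mono a x x' y y' :
  a x = Some y -> a x' = Some y' -> (x <= x')%O -> (y <= y')%O.
Proof. by case: (pfunP a) => _ + _ _; apply. Qed.

Lemma IO_refl a x x' y y' :
  a x = Some y -> a x' = Some y' -> (y <= y')%O -> (x <= x')%O.
Proof.
move=> xy xy' yy'; case: (leP x x') => // x'x.
have y'y := IO_mono xy' xy (ltW x'x).
have e : y = y' by apply/eqP; rewrite eq_le yy' y'y.
by subst y'; rewrite (IO_inj xy xy') ltxx in x'x.
Qed.

Lemma IO_dom a : finite_set (~` pdom a).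
Proof. by case: (pfunP a). Qed.

Lemma IO_ran a : finite_set (~` pran a).
Proof. by case: (pfunP a). Qed.

Lemma IO_pinvE a x y : pinv a y = Some x <-> a x = Some y.
Proof.
rewrite /pinv; case: pselect => [P|nP].
  case: (cid P) => x' /= x'y; split=> [[<-] //|xy].
  by rewrite (IO_inj x'y xy).
by split=> // xy; case: nP; exists x.
Qed.

Lemma IO_one_subproof : IO_axiom (@Some T).
Proof.
split=> [x x' y [->] [->] //|x x' y y' [<-] [<-] //|/=|/=].
  by apply: sub_finite_set (@finite_set0 T) => x /= []; exists x.
by apply: sub_finite_set (@finite_set0 T) => x /= []; exists x.
Qed.

Definition IO_one : IO T := MkIO IO_one_subproof.

(* The product follows the right-action convention x(ab) = (xa)b. *)
Lemma IO_mul_subproof a b : IO_axiom (fun x => obind b (a x)).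
Proof.
have K x z : obind b (a x) = Some z -> exists2 y, a x = Some y & b y = Some z.
  by case: (a x) => //= y; exists y.
split=> [x x' z /K[y xy yz] /K[y' xy' yz']||/=|/=].
- by move: (IO_inj yz yz') xy' => <-; apply: IO_inj.
- move=> x x' z z' /K[y xy yz] /K[y' xy' yz'] xx'.
  exact: IO_mono yz yz' (IO_mono xy xy' xx').
- apply: (@sub_finite_set _ _
    (~` pdom a `|` (fun y => odflt y (pinv a y)) @` (~` pdom b))); last first.
    by rewrite finite_setU; split; [exact: IO_dom | apply/finite_image/IO_dom].
  move=> x /= xN; case ax : (a x) => [y|]; last first.
    by left=> /=; case=> y; rewrite ax.
  right; exists y.
    by case=> z yz; apply: xN; exists z; rewrite ax.
  by move/IO_pinvE: ax => ->.
- apply: (@sub_finite_set _ _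
    (~` pran b `|` (fun y => odflt y (b y)) @` (~` pran a))); last first.
    by rewrite finite_setU; split; [exact: IO_ran | apply/finite_image/IO_ran].
  move=> z /= zN; case: (pselect (pran b z)) => [[y yz]|]; last by left.
  right; exists y; last by rewrite yz.
  by case=> x xy; apply: zN; exists x; rewrite xy.
Qed.

Definition IO_mul a b : IO T := MkIO (IO_mul_subproof a b).

HB.instance Definition _ := gen_eqMixin (IO T).
HB.instance Definition _ := gen_choiceMixin (IO T).

Lemma IO_mulA : associative IO_mul.
Proof. by move=> a b c; apply: IO_ext => x /=; case: (a x). Qed.

Lemma IO_mul1 : left_id IO_one IO_mul.
Proof. by move=> a; apply: IO_ext. Qed.

Lemma IO_mulr1 : right_id IO_one IO_mul.
Proof. by move=> a; apply: IO_ext => x /=; case: (a x). Qed.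

HB.instance Definition _ := isMonoid.Build (IO T) IO_mulA IO_mul1 IO_mulr1.

Lemma IO_inv_subproof a : IO_axiom (pinv a).
Proof.
split=> [y y' x /IO_pinvE xy /IO_pinvE
        |y y' x x' /IO_pinvE xy /IO_pinvE xy'|/=|/=].
- by rewrite xy => -[].
- exact: IO_refl xy xy'.
- apply: sub_finite_set (IO_ran a) => y /= yN [x /IO_pinvE xy].
  by apply: yN; exists x.
- apply: sub_finite_set (IO_dom a) => x /= xN [y /IO_pinvE xy].
  by apply: xN; exists y.
Qed.

Definition IO_inv a : IO T := MkIO (IO_inv_subproof a).

End IOMonoid.

Section Automorphisms.
Variable S : monoidType.

Definition is_automorphism (f : S -> S) : Prop :=
  [/\ bijective f, f 1%g = 1%g & {morph f : s t / (s * t)%g}].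

(* [b] is the inverse of the unit [a]. *)
Definition is_inner (f : S -> S) : Prop :=
  exists a b : S, [/\ (a * b = 1)%g, (b * a = 1)%g &
                      forall s, f s = (a * s * b)%g].

End Automorphisms.

(** [L_n = {1, ..., n}] is represented by the 0-based ['I_n] and the lexicographic product is
    MathComp's [*l], so that [IO (Zlex n)] is the monoid IO_oo(Z^n_lex), and
    [IO int] is IO_oo(Z). *)

Notation Zlex n := ('I_n *l int)%type.

Section Identification.
Variable n : nat.
Implicit Types (a : IO (Zlex n)) (i j : 'I_n) (k l m : int).

Lemma finite_int_itv k l : finite_set [set m : int | (k <= m <= l)%R].
Proof.
apply: (@sub_finite_set _ _
  ((fun p : nat => (k + p%:Z)%R) @` `I_(absz (l - k)%R).+1)).
  by move=> m /= km; exists (absz (m - k)%R); lia.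
exact/finite_image/finite_II.
Qed.

Lemma infinite_int_gt l : ~ finite_set [set m : int | (l < m)%R].
Proof.
move=> /(finite_image (fun m => absz (m - l - 1)%R)) fin.
apply: infinite_nat; apply: sub_finite_set fin => p _ /=.
by exists (l + p%:Z + 1)%R; lia.
Qed.

Lemma lexE (x y : Zlex n) :
  (x <= y)%O = (x.1 < y.1)%O || ((x.1 == y.1) && (x.2 <= y.2)%O).
Proof. by rewrite leEprodlexi; case: ltgtP. Qed.

Lemma IO_fst_le a i k k' j j' l l' :
  a (i, k) = Some (j, l) -> a (i, k') = Some (j', l') -> (j' <= j)%O.
Proof.
move=> e e'; case: leP => // jj'; exfalso.
apply: (@infinite_int_gt l).
apply: (@sub_finite_set _ _
  (snd @` (~` pran a) `|`
   (fun p => if a (i, p) is Some x then x.2 else 0%R)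
     @` [set p : int | (k <= p <= k')%R])).
  move=> m /= lm; case: (pselect (pran a (j, m))) => [[[i0 p] ep]|]; last first.
    by left; exists (j, m).
  have := IO_refl e ep; rewrite !lexE /= eqxx ltxx (ltW lm) => /(_ isT).
  have := IO_refl ep e'; rewrite !lexE /= jj' => /(_ isT).
  case: (ltgtP i0 i) => //= ei pk' kp; subst i0.
  by right; exists p; rewrite ?ep //= kp pk'.
rewrite finite_setU; split; first exact/finite_image/IO_ran.
exact/finite_image/finite_int_itv.
Qed.

Lemma IO_fst_eq a i k k' j j' l l' :
  a (i, k) = Some (j, l) -> a (i, k') = Some (j', l') -> j = j'.
Proof.
by move=> e e'; apply/eqP; rewrite eq_le (IO_fst_le e e') (IO_fst_le e' e).
Qed.

Lemma IO_fiber a i : finite_set [set k | ~ pdom a (i, k)].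
Proof.
apply: (@sub_finite_set _ _ (snd @` (~` pdom a))).
  by move=> k /= kN; exists (i, k).
exact/finite_image/IO_dom.
Qed.

Lemma IO_fiber_ran a i : finite_set [set k | ~ pran a (i, k)].
Proof.
apply: (@sub_finite_set _ _ (snd @` (~` pran a))).
  by move=> k /= kN; exists (i, k).
exact/finite_image/IO_ran.
Qed.

(* Every element of IO_oo(Z^n_lex) preserves the first coordinate. *)
Lemma IO_fst a i k j l : a (i, k) = Some (j, l) -> j = i.
Proof.
have dom0 i' : exists k', pdom a (i', k').
  apply: contrapT => /forallNP h; apply: (@infinite_int_gt 0).
  by apply: sub_finite_set (IO_fiber a i') => m _; exact: h.
pose g i' := if a (i', projT1 (cid (dom0 i'))) is Some x then x.1 else i'.
have gE i' k' j' l' : a (i', k') = Some (j', l') -> g i' = j'.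
  rewrite /g; case: cid => k0 /= [[j0 l0] e0] e; rewrite e0 /=.
  exact: IO_fst_eq e0 e.
have glt : {homo g : x y / (x < y)%O}.
  move=> x y xy; case: (cid (dom0 x)) => k1 [[j1 l1] e1].
  case: (cid (dom0 y)) => k2 [[j2 l2] e2].
  rewrite (gE _ _ _ _ e1) (gE _ _ _ _ e2).
  have := IO_mono e1 e2; rewrite !lexE /= xy => /(_ isT).
  case/orP => // /andP[/eqP ej _]; subst j2.
  move/IO_pinvE: e1 => e1; move/IO_pinvE: e2 => e2.
  by move: xy; rewrite (@IO_fst_eq (IO_inv a) _ _ _ _ _ _ _ e1 e2) ltxx.
have gid : g =1 id.
  apply: (@Order.mono_unique _ 'I_n 'I_n) => //; first exact: le_total.
  exact: le_mono.
by move=> e; rewrite -(gE _ _ _ _ e) gid.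
Qed.

Lemma proj_subproof a i : IO_axiom (fun k => omap snd (a (i, k))).
Proof.
have K k l : omap snd (a (i, k)) = Some l <-> a (i, k) = Some (i, l).
  split=> [|-> //]; case e: (a (i, k)) => [[j l']|] //= [<-].
  by rewrite (IO_fst e).
split=> [k k' l /K e /K e'|k k' l l' /K e /K e' kk'|/=|/=].
- by case: (IO_inj e e').
- have := IO_mono e e'; rewrite !lexE /= eqxx ltxx /=; exact.
- apply: sub_finite_set (IO_fiber a i) => k /= kN [[j l] e].
  by apply: kN; exists l; apply/K; rewrite e (IO_fst e).
- apply: sub_finite_set (IO_fiber_ran a i) => l /= lN [[j k] e].
  by have ij := IO_fst e; subst j; apply: lN; exists k; apply/K.
Qed.

(* The i-th component alpha_i of alpha. *)
Definition proj a i : IO int := MkIO (proj_subproof a i).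

Definition to_power a : {ffun 'I_n -> IO int} := [ffun i => proj a i].

Lemma of_power_subproof (u : {ffun 'I_n -> IO int}) :
  IO_axiom (fun x : Zlex n => omap (pair x.1) (u x.1 x.2) : option (Zlex n)).
Proof.
have K x y : omap (pair x.1) (u x.1 x.2) = Some y <->
    y.1 = x.1 /\ u x.1 x.2 = Some y.2.
  case: (u x.1 x.2) y => [m|] [j l] /=; last by split=> // -[].
  by split=> [[-> ->] //|[-> [->]]].
split=> [x x' y /K[y1 e] /K[y1' e']|x x' y y' /K[y1 e] /K[y1' e']|/=|/=].
- have e1 : x.1 = x'.1 by rewrite -y1 -y1'.
  rewrite -e1 in e'; have e2 := IO_inj e e'.
  by move: x x' e1 e2 {y1 y1' e e'} => [? ?] [? ?] /= -> ->.
- rewrite !lexE y1 y1'; case/orP => [-> //|/andP[/eqP e1 xx']].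
  by rewrite e1 eqxx /= in e *; rewrite (IO_mono e e' xx') orbT.
- apply: (@sub_finite_set _ _ (\bigcup_(i in [set: 'I_n])
      (fun k : int => (i, k)) @` (~` pdom (u i)))).
    move=> [i k] /= kN; exists i => //; exists k => // -[l e].
    by apply: kN; exists (i, l); apply/(K (i, k)).
  apply: bigcup_finite => [|i _]; first exact: finite_finset.
  exact/finite_image/IO_dom.
- apply: (@sub_finite_set _ _ (\bigcup_(i in [set: 'I_n])
      (fun k : int => (i, k)) @` (~` pran (u i)))).
    move=> [i l] /= lN; exists i => //; exists l => // -[k e].
    by apply: lN; exists (i, k); apply/(K (i, k)).
  apply: bigcup_finite => [|i _]; first exact: finite_finset.
  exact/finite_image/IO_ran.
Qed.

(* (i, k)alpha = (i, (k)alpha_i) *)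
Definition of_power (u : {ffun 'I_n -> IO int}) : IO (Zlex n) :=
  MkIO (of_power_subproof u).

Lemma of_powerK : cancel of_power to_power.
Proof.
move=> u; apply/ffunP => i; rewrite ffunE; apply: IO_ext => k /=.
by case: (u i k).
Qed.

Lemma to_powerK : cancel to_power of_power.
Proof.
move=> a; apply: IO_ext => -[i k] /=; rewrite ffunE /=.
by case e : (a (i, k)) => [[j l]|] //=; rewrite (IO_fst e).
Qed.

(* The product of [{ffun 'I_n -> IO int}] is componentwise: this type is the
   direct power IO_oo(Z)^n. *)
Lemma of_powerM : {morph of_power : u v / (u * v)%g}.
Proof.
move=> u v; apply: IO_ext => -[i k] /=; rewrite ffunE /=.
by case: (u i k).
Qed.

Definition swap12 (n2 : (2 <= n)%N) (u : {ffun 'I_n -> IO int}) :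
    {ffun 'I_n -> IO int} :=
  [ffun i => u (tperm (Ordinal (ltnW n2)) (Ordinal n2) i)].

(* (alpha_1, alpha_2, alpha_3, ..., alpha_n) |->
   (alpha_2, alpha_1, alpha_3, ..., alpha_n) *)
Definition swap_map (n2 : (2 <= n)%N) (a : IO (Zlex n)) : IO (Zlex n) :=
  of_power (swap12 n2 (to_power a)).

End Identification.

(* Main.v *)
Require Import Defs.
From mathcomp Require Import all_boot all_order all_algebra all_fingroup.
From mathcomp Require Import boolp classical_sets cardinality.

(** The swap is an involution respecting the componentwise product. An inner
    automorphism preserves the set of indices [i] such that the [i]-th component
    is the identity, because units preserve the first coordinate; the swap moves
    a non-identity component from index 1 to index 2. *)

Set Implicit Arguments.
Unset Strict Implicit.
Unset Printing Implicit Defensive.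

Local Open Scope classical_set_scope.

Section Puncture.
Context {d : Order.disp_t} {T : orderType d}.

Lemma puncture_subproof (x0 : T) :
  IO_axiom (fun x => if x == x0 then None else Some x).
Proof.
have K x y : (if x == x0 then None else Some x) = Some y -> x = y.
  by case: eqP => // _ [].
split=> [x x' y /K-> /K-> //|x x' y y' /K-> /K-> //|/=|/=];
  apply: sub_finite_set (finite_set1 x0) => x /= xN; apply: contrapT => /eqP x0N;
  by apply: xN; exists x; rewrite (negbTE x0N).
Qed.

(** An idempotent other than the identity: the partial identity on the complement of one point. It
    is the simplest component that the swap can visibly move. *)
Definition puncture (x0 : T) : IO T := MkIO (puncture_subproof x0).

End Puncture.

Section Swap.
Variable n : nat.

Lemma of_power1 : of_power (1%g : {ffun 'I_n -> IO int}) = 1%g.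
Proof. by apply: IO_ext => -[i k] /=; rewrite ffunE. Qed.

Lemma to_power1 : to_power (1%g : IO (Zlex n)) = 1%g.
Proof. by rewrite -of_power1 of_powerK. Qed.

(** The inverse of a multiplicative bijection is multiplicative. *)
Lemma to_powerM : {morph @to_power n : a b / (a * b)%g}.
Proof.
move=> a b; rewrite -[in LHS](to_powerK a) -[in LHS](to_powerK b).
by rewrite -of_powerM of_powerK.
Qed.

Variable n2 : (2 <= n)%N.

Lemma swap12K : involutive (swap12 n2).
Proof. by move=> u; apply/ffunP => i; rewrite !ffunE tpermK. Qed.

Lemma swap12_1 : swap12 n2 1%g = 1%g.
Proof. by apply/ffunP => i; rewrite !ffunE. Qed.

Lemma swap12M : {morph swap12 n2 : u v / (u * v)%g}.
Proof. by move=> u v; apply/ffunP => i; rewrite !ffunE. Qed.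

Lemma swap_map_automorphism : is_automorphism (swap_map n2).
Proof.
split.
- have K : involutive (swap_map n2).
    by move=> a; rewrite /swap_map of_powerK swap12K to_powerK.
  by exists (swap_map n2).
- by rewrite /swap_map to_power1 swap12_1 of_power1.
- by move=> a b; rewrite /swap_map to_powerM swap12M of_powerM.
Qed.

Lemma inner_fix (f : IO (Zlex n) -> IO (Zlex n)) (s : IO (Zlex n)) i :
  is_inner f -> (forall k, s (i, k) = Some (i, k)) ->
  forall k, f s (i, k) = Some (i, k).
Proof.
move=> [a [b [ab _ fE]]] sE k.
have /= := congr1 (fun c : IO (Zlex n) => c (i, k)) ab.
(* Since [a * b = 1], [a] is defined at [(i, k)] and [b] sends its value back to [(i, k)]. That
   value lies in the copy [i], where [s] fixes every point, so inserting [s] between [a] and [b]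
   changes nothing there. *)
rewrite fE /=; case e: (a (i, k)) => [[j l]|] //=.
by rewrite (IO_fst e) sE.
Qed.

Lemma swap_map_not_inner : ~ is_inner (swap_map n2).
Proof.
set i1 := Ordinal (ltnW n2); set i2 := Ordinal n2.
pose u := [ffun i : 'I_n => if i == i1 then puncture (0%R : int) else 1%g].
move=> /(inner_fix (s := of_power u) (i := i2)) fixed.
(* The evaluation point 0 is the puncture: after the swap, component [i2] is undefined there,
   against [fixed]. *)
have /fixed /(_ 0%R) : forall k, of_power u (i2, k) = Some (i2, k).
  by move=> k; rewrite /= ffunE.
by rewrite /swap_map of_powerK /= !ffunE tpermR eqxx.
Qed.

End Swap.

Theorem mainTheorem10 (n : nat) (n2 : (2 <= n)%N) :
  is_automorphism (S := IO (Zlex n)) (swap_map n2) /\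
  ~ is_inner (S := IO (Zlex n)) (swap_map n2).
Proof. by split; [exact: swap_map_automorphism | exact: swap_map_not_inner]. Qed.
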